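(* (Error decomposition for discrete latent dynamics models.) Let $(\Psi,\Psi',\mathbf{f}_n)$ be a latent dynamics model for $\mathbf{u}_h$ with latent state $\mathbf{u}_n$ and $\Psi'$ continuously differentiable, and let $\tilde{\mathbf{u}}_h^k(\boldsymbol{\mu})=\Psi'(\mathbf{u}_n^k(\boldsymbol{\mu}))$ be the discrete approximation obtained with an explicit one-step scheme of order $p$ and step $\Delta t$, so that $\|\mathbf{u}_n(t_k;\boldsymbol{\mu})-\mathbf{u}_n^k(\boldsymbol{\mu})\|\le C\Delta t^p$ for all $k$, with $C$ independent of $\Delta t$ and $k$ (see context). Then, for every $\boldsymbol{\mu}\in\mathcal{P}$ and every $k=0,\dots,N_{\Delta t}$, $$\|\mathbf{u}_h(t_k;\boldsymbol{\mu})-\tilde{\mathbf{u}}_h^k(\boldsymbol{\mu})\|\le C_1+C_2\,\Delta t^p,$$ where $C_2=Lip(\Psi')\,C$ and $$C_1=\|\mathbf{u}_{0,h}-\Psi'\circ\Psi(\mathbf{u}_{0,h})\|_{L^\infty(\mathcal{P};\mathbb{R}^{N_h})}+|T-t_0|\,\|\mathbf{f}_h(\mathbf{u}_h)-\mathbf{J}_{\Psi',\mathbf{u}_n}\mathbf{f}_n(\mathbf{u}_n)\|_{L^\infty([t_0,T]\times\mathcal{P};\mathbb{R}^{N_h})}.$$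
   Context: $\mathcal{P}\subset\mathbb{R}^{n_\mu}$ is compact, $\|\cdot\|$ is the Euclidean norm; for the continuous functions involved, the $L^\infty$ norm is the supremum of the Euclidean norm (vector fields being evaluated for $t\in(t_0,T]$). $Lip(\Psi')$ is the Lipschitz constant of $\Psi'$. $\mathbf{J}_{\Psi',\mathbf{u}_n}(t;\boldsymbol{\mu})$ is the Jacobian of $\Psi'$ at $\mathbf{u}_n(t;\boldsymbol{\mu})$; $\mathbf{f}_h(\mathbf{u}_h)$ and $\mathbf{f}_n(\mathbf{u}_n)$ denote $(t,\boldsymbol{\mu})\mapsto\mathbf{f}_h(t,\mathbf{u}_h(t;\boldsymbol{\mu});\boldsymbol{\mu})$ and $(t,\boldsymbol{\mu})\mapsto\mathbf{f}_n(t,\mathbf{u}_n(t;\boldsymbol{\mu});\boldsymbol{\mu})$. Full-order model: $\mathbf{u}_h\in C^1([t_0,T]\times\mathcal{P};\mathbb{R}^{N_h})$ satisfies $\dot{\mathbf{u}}_h(t;\boldsymbol{\mu})=\mathbf{f}_h(t,\mathbf{u}_h(t;\boldsymbol{\mu});\boldsymbol{\mu})$ for $t\in(t_0,T]$, $\mathbf{u}_h(t_0;\boldsymbol{\mu})=\mathbf{u}_{0,h}(\boldsymbol{\mu})$. Latent dynamics model: with $n\ll N_h$, a triple $(\Psi,\Psi',\mathbf{f}_n)$ of Lipschitz maps $\Psi:\mathbb{R}^{N_h}\to\mathbb{R}^n$, $\Psi':\mathbb{R}^n\to\mathbb{R}^{N_h}$ and a latent vector field $\mathbf{f}_n(t,\mathbf{u}_n;\boldsymbol{\mu})\in\mathbb{R}^n$,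 which solves $$\min_{\Psi',\mathbf{u}_n}\|\mathbf{u}_h-\Psi'(\mathbf{u}_n)\|^2_{L^2([t_0,T]\times\mathcal{P};\mathbb{R}^{N_h})}\ \text{ s.t. }\ \dot{\mathbf{u}}_n(t;\boldsymbol{\mu})=\mathbf{f}_n(t,\mathbf{u}_n(t;\boldsymbol{\mu});\boldsymbol{\mu}),\ t\in(t_0,T],\quad\mathbf{u}_n(t_0;\boldsymbol{\mu})=\Psi(\mathbf{u}_{0,h}(\boldsymbol{\mu})),$$ with latent state $\mathbf{u}_n\in C^1([t_0,T]\times\mathcal{P};\mathbb{R}^n)$. The vector fields $\mathbf{f}_h,\mathbf{f}_n$ are continuous, bounded, and locally Lipschitz in their second argument uniformly in $t$ and $\boldsymbol{\mu}$. Discretization: $[t_0,T]$ is divided into $N_{\Delta t}$ intervals of width $\Delta t$, $t_k=t_0+k\Delta t$; $\mathbf{u}_n^k(\boldsymbol{\mu})=\mathbf{u}_n^{k-1}(\boldsymbol{\mu})+\Delta t\,\Phi(t_{k-1},\mathbf{u}_n^{k-1}(\boldsymbol{\mu});\Delta t,\mathbf{f}_n,\boldsymbol{\mu})$ for $k=1,\dots,N_{\Delta t}$, $\mathbf{u}_n^0(\boldsymbol{\mu})=\Psi(\mathbf{u}_{0,h}(\boldsymbol{\mu}))$, where $\Phi$ is the increment function of an explicit one-step (Runge-Kutta) scheme. *)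

(* Defs.v *)
From HB Require Import structures.
From mathcomp Require Import all_boot all_order all_algebra.
From mathcomp Require Import all_classical all_reals all_analysis.

Set Implicit Arguments.
Unset Strict Implicit.
Unset Printing Implicit Defensive.

Import Order.TTheory GRing.Theory Num.Theory.
Import numFieldNormedType.Exports.

Local Open Scope classical_set_scope.
Local Open Scope ring_scope.

(* Vectors are row vectors.  The library norm `|v| on 'rV[R]_m is the maximum
   norm, so the Euclidean norm is defined separately; both induce the same
   topology, and hence the same notions of compactness, continuity and
   differentiability. *)
Definition enorm (R : realType) (m : nat) (v : 'rV[R]_m) : R :=
  Num.sqrt (\sum_(i < m) v 0 i ^+ 2).

(* A real supremum: it equals the library default 0 when the set of values is
   empty or unbounded. *)
Definition Linf (R : realType) (X : Type) (m : nat) (D : set X)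
    (f : X -> 'rV[R]_m) : R :=
  sup [set enorm (f x) | x in D].

Definition is_lipschitz_const (R : realType) (m1 m2 : nat)
    (f : 'rV[R]_m1 -> 'rV[R]_m2) (L : R) : Prop :=
  0 <= L /\ forall x y, enorm (f x - f y) <= L * enorm (x - y).

Definition is_lipschitz (R : realType) (m1 m2 : nat)
    (f : 'rV[R]_m1 -> 'rV[R]_m2) : Prop :=
  exists L, is_lipschitz_const f L.

Definition Lip (R : realType) (m1 m2 : nat) (f : 'rV[R]_m1 -> 'rV[R]_m2) : R :=
  inf [set L | is_lipschitz_const f L].

(* For open U.  In finite dimension, continuity of x |-> 'd f x is the
   continuity of x |-> 'd f x v for every direction v. *)
Definition C1_open (R : realType) (V W : normedModType R) (U : set V)
    (f : V -> W) : Prop :=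
  forall x, U x ->
    differentiable f x /\ forall v, {for x, continuous (fun y => 'd f y v)}.

(* On a set K that need not be open, C^1 means that f is the restriction to K
   of a C^1 function on an open neighbourhood of K. *)
Definition C1_on (R : realType) (V W : normedModType R) (K : set V)
    (f : V -> W) : Prop :=
  exists (U : set V) (g : V -> W),
    [/\ open U, K `<=` U, C1_open U g & forall x, K x -> g x = f x].

Definition C1_state (R : realType) (nmu m : nat) (t0 T : R)
    (P : set 'rV[R]_nmu) (u : R -> 'rV[R]_nmu -> 'rV[R]_m) : Prop :=
  C1_on (`[t0, T]%classic `*` P)
    (fun z : R * 'rV[R]_nmu => u z.1 z.2).

(* Derivative of a function defined on D: one-sided at an end point of D. *)
Definition derivative_within (R : realType) (m : nat) (D : set R)
    (v : R -> 'rV[R]_m) (t : R) (d : 'rV[R]_m) : Prop :=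
  (fun s => (s - t)^-1 *: (v s - v t)) @ within D t^' --> d.

Definition solves_ivp (R : realType) (nmu m : nat) (t0 T : R)
    (P : set 'rV[R]_nmu) (f : R -> 'rV[R]_m -> 'rV[R]_nmu -> 'rV[R]_m)
    (u0 : 'rV[R]_nmu -> 'rV[R]_m) (u : R -> 'rV[R]_nmu -> 'rV[R]_m) : Prop :=
  forall mu, P mu ->
    (forall t, t0 < t <= T ->
       derivative_within `[t0, T]%classic (u ^~ mu) t (f t (u t mu) mu)) /\
    u t0 mu = u0 mu.

Definition loc_lipschitz_unif (R : realType) (nmu m : nat) (t0 T : R)
    (P : set 'rV[R]_nmu) (f : R -> 'rV[R]_m -> 'rV[R]_nmu -> 'rV[R]_m) : Prop :=
  forall x0, exists L r, 0 < r /\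
    forall t mu x y, t0 < t <= T -> P mu ->
      enorm (x - x0) < r -> enorm (y - x0) < r ->
      enorm (f t x mu - f t y mu) <= L * enorm (x - y).

Record admissible_field (R : realType) (nmu m : nat) (t0 T : R)
    (P : set 'rV[R]_nmu) (f : R -> 'rV[R]_m -> 'rV[R]_nmu -> 'rV[R]_m) :
    Prop := AdmissibleField {
  field_cont : {within `]t0, T]%classic `*` setT `*` P,
    continuous (fun z : R * 'rV[R]_m * 'rV[R]_nmu => f z.1.1 z.1.2 z.2)};
  field_bounded : exists M, forall t x mu, t0 < t <= T -> P mu ->
    enorm (f t x mu) <= M;
  field_lip : loc_lipschitz_unif t0 T P f }.

Record full_order_model (R : realType) (nmu Nh : nat) (t0 T : R)
    (P : set 'rV[R]_nmu) (fh : R -> 'rV[R]_Nh -> 'rV[R]_nmu -> 'rV[R]_Nh)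
    (u0h : 'rV[R]_nmu -> 'rV[R]_Nh) (uh : R -> 'rV[R]_nmu -> 'rV[R]_Nh) :
    Prop := FullOrderModel {
  fom_field : admissible_field t0 T P fh;
  fom_C1 : C1_state t0 T P uh;
  fom_ivp : solves_ivp t0 T P fh u0h uh }.

(* Lebesgue integral over R^m of a nonnegative Borel function, as the iterated
   integral over the coordinates; by Tonelli's theorem it is the integral
   against the m-dimensional Lebesgue measure. *)
Fixpoint rV_integral (R : realType) (m : nat) : ('rV[R]_m -> \bar R) -> \bar R :=
  match m with
  | 0 => fun g => g 0
  | m'.+1 => fun g =>
      (\int[@lebesgue_measure R]_x
         rV_integral (fun v : 'rV[R]_m' => g (row_mx (x%:M : 'rV[R]_1) v)))%E
  end.

(* ||u - v||^2 in L^2([t0, T] x P; R^m). *)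
Definition L2_sqdist (R : realType) (nmu m : nat) (t0 T : R)
    (P : set 'rV[R]_nmu) (u v : R -> 'rV[R]_nmu -> 'rV[R]_m) : \bar R :=
  (\int[@lebesgue_measure R]_(t in `[t0, T]%classic)
     rV_integral (fun mu => (\1_P mu * enorm (u t mu - v t mu) ^+ 2)%:E))%E.

Definition latent_state (R : realType) (nmu Nh n : nat) (t0 T : R)
    (P : set 'rV[R]_nmu) (u0h : 'rV[R]_nmu -> 'rV[R]_Nh)
    (Psi : 'rV[R]_Nh -> 'rV[R]_n)
    (fn : R -> 'rV[R]_n -> 'rV[R]_nmu -> 'rV[R]_n)
    (un : R -> 'rV[R]_nmu -> 'rV[R]_n) : Prop :=
  C1_state t0 T P un /\ solves_ivp t0 T P fn (fun mu => Psi (u0h mu)) un.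

(* The minimization is over the pairs (Psi', un) of a Lipschitz map and a
   latent state satisfying the constraint given by Psi and fn. *)
Record latent_dynamics_model (R : realType) (nmu Nh n : nat) (t0 T : R)
    (P : set 'rV[R]_nmu) (u0h : 'rV[R]_nmu -> 'rV[R]_Nh)
    (uh : R -> 'rV[R]_nmu -> 'rV[R]_Nh)
    (Psi : 'rV[R]_Nh -> 'rV[R]_n) (Psi' : 'rV[R]_n -> 'rV[R]_Nh)
    (fn : R -> 'rV[R]_n -> 'rV[R]_nmu -> 'rV[R]_n)
    (un : R -> 'rV[R]_nmu -> 'rV[R]_n) : Prop := LatentDynamicsModel {
  ldm_enc : is_lipschitz Psi;
  ldm_dec : is_lipschitz Psi';
  ldm_field : admissible_field t0 T P fn;
  ldm_state : latent_state t0 T P u0h Psi fn un;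
  ldm_min : forall (Xi' : 'rV[R]_n -> 'rV[R]_Nh)
      (vn : R -> 'rV[R]_nmu -> 'rV[R]_n),
    is_lipschitz Xi' -> latent_state t0 T P u0h Psi fn vn ->
    (L2_sqdist t0 T P uh (fun t mu => Psi' (un t mu)) <=
     L2_sqdist t0 T P uh (fun t mu => Xi' (vn t mu)))%E }.

Definition time_step (R : realType) (t0 T : R) (N : nat) : R :=
  (T - t0) / N%:R.

Definition time_grid (R : realType) (t0 T : R) (N k : nat) : R :=
  t0 + k%:R * time_step t0 T N.

(* Arguments t, u, dt, f, mu of the increment function Phi(t, u; dt, f, mu) of
   an explicit one-step scheme. *)
Definition increment_function (R : realType) (nmu n : nat) : Type :=
  R -> 'rV[R]_n -> R -> (R -> 'rV[R]_n -> 'rV[R]_nmu -> 'rV[R]_n) ->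
  'rV[R]_nmu -> 'rV[R]_n.

Fixpoint one_step (R : realType) (nmu n : nat)
    (Phi : increment_function R nmu n) (t0 T : R)
    (f : R -> 'rV[R]_n -> 'rV[R]_nmu -> 'rV[R]_n)
    (u0 : 'rV[R]_nmu -> 'rV[R]_n) (N k : nat) (mu : 'rV[R]_nmu) : 'rV[R]_n :=
  if k is k'.+1 then
    one_step Phi t0 T f u0 N k' mu + time_step t0 T N *:
      Phi (time_grid t0 T N k') (one_step Phi t0 T f u0 N k' mu)
        (time_step t0 T N) f mu
  else u0 mu.

(* Main.v *)
Require Import Defs.
From HB Require Import structures.
From mathcomp Require Import all_boot all_order all_algebra.
From mathcomp Require Import all_classical all_reals all_analysis.
From mathcomp Require Import ring lra.

Set Implicit Arguments.
Unset Strict Implicit.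
Unset Printing Implicit Defensive.

Import Order.TTheory GRing.Theory Num.Theory.
Import numFieldNormedType.Exports.

Local Open Scope classical_set_scope.
Local Open Scope ring_scope.

(** Fix [mu]. By the triangle inequality the error at [t_k] is at most
    [|e(t_k)| + |Psi'(un(t_k)) - Psi'(un^k)|], where
    [e(t) = uh(t) - Psi'(un(t))] is the error of the time-continuous model. The
    second term is at most [Lip Psi' * C * dt^p], because the infimum [Lip Psi']
    is itself a Lipschitz constant ([is_lipschitz_const_Lip]).

    For the first term, the chain rule gives
    [e' = fh(uh) - J_{Psi', un} fn(un)] inside the time interval, and the mean
    value inequality ([enorm_mean_value]) yields
    [|e(t_k)| <= |e(t_0)| + (t_k - t_0) sup |e'|]. The initial value [e(t_0)] is
    the reconstruction error of the initial datum, so both terms are bounded by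
    the suprema defining [C1]; no Gronwall argument enters, since the residual
    is evaluated along the exact trajectories.

    A supremum of an unbounded set of reals is 0 by convention, hence both sets
    of values must be shown bounded before [enorm_le_Linf] applies. For the
    initial error this follows from compactness of [P] and continuity of the
    states ([C1_on_enorm_bounded]); for the residual, from the boundedness of
    the vector fields and the bound of the Jacobian by the Lipschitz constant
    ([enorm_mulmx_jacobian]). *)

(** * The Euclidean norm *)

Definition dotv (R : realType) (m : nat) (u v : 'rV[R]_m) : R :=
  \sum_(i < m) u 0 i * v 0 i.

Section EuclideanNorm.
Context (R : realType) (m : nat).
Implicit Types (u v w : 'rV[R]_m) (a : R).

Lemma enorm_ge0 v : 0 <= enorm v.
Proof. exact: sqrtr_ge0. Qed.

Lemma sqr_enorm v : enorm v ^+ 2 = dotv v v.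
Proof.
rewrite sqr_sqrtr; first by apply: eq_bigr => i _; rewrite expr2.
by apply: sumr_ge0 => i _; exact: sqr_ge0.
Qed.

Lemma enormZ a v : enorm (a *: v) = `|a| * enorm v.
Proof.
rewrite /enorm; under eq_bigr do rewrite mxE exprMn.
by rewrite -mulr_sumr sqrtrM ?sqr_ge0// sqrtr_sqr.
Qed.

Lemma enormN v : enorm (- v) = enorm v.
Proof. by rewrite -scaleN1r enormZ normrN1 mul1r. Qed.

Lemma sqr_enormD u v :
  enorm (u + v) ^+ 2 = enorm u ^+ 2 + dotv u v *+ 2 + enorm v ^+ 2.
Proof.
rewrite !sqr_enorm /dotv -sumrMnl -!big_split /=.
by apply: eq_bigr => i _; rewrite !mxE; ring.
Qed.

Lemma dotvC u v : dotv u v = dotv v u.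
Proof. by apply: eq_bigr => i _; rewrite mulrC. Qed.

Lemma dotvZr a u v : dotv u (a *: v) = a * dotv u v.
Proof.
by rewrite /dotv mulr_sumr; apply: eq_bigr => i _; rewrite mxE mulrCA.
Qed.

Lemma dotvB u v w : dotv u (v - w) = dotv u v - dotv u w.
Proof.
by rewrite /dotv -sumrB; apply: eq_bigr => i _; rewrite !mxE mulrBr.
Qed.

(** Cauchy-Schwarz, from the nonnegativity of the square of the norm of
    |v| u - |u| v, which is 2 |u| |v| (|u| |v| - <u, v>). *)
Lemma dotv_le_enorm u v : dotv u v <= enorm u * enorm v.
Proof.
have [u0 v0] := (enorm_ge0 u, enorm_ge0 v).
have := sqr_ge0 (enorm (enorm v *: u + (- enorm u) *: v)).
rewrite sqr_enormD !enormZ normrN !ger0_norm// dotvZr dotvC dotvZr dotvC.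
(* The product of the norms can be cancelled unless it is zero, in which case
   one of the vectors vanishes. *)
have [uv0|] := eqVneq (enorm u * enorm v) 0; last first.
  move=> uv_neq0; have uv0 : 0 < enorm u * enorm v.
    by rewrite lt_neqAle eq_sym uv_neq0 mulr_ge0.
  move=> H; rewrite -subr_ge0 -(pmulr_rge0 _ uv0).
  by move: H; rewrite !expr2; nra.
rewrite uv0 => _.
have dot0 (x y : 'rV[R]_m) : enorm x = 0 -> dotv x y = 0.
  move=> x0; have := sqr_enorm x; rewrite x0 expr0n/= => /esym/eqP.
  rewrite /dotv psumr_eq0 => [/allP x0'|i _]; last by rewrite -expr2 sqr_ge0.
  apply: big1 => i _; have := x0' i (mem_index_enum _).
  by rewrite -expr2 sqrf_eq0 => /eqP ->; rewrite mul0r.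
move/eqP: uv0; rewrite mulf_eq0 => /orP[]/eqP/dot0 H; first by rewrite H.
by rewrite dotvC H.
Qed.

Lemma ler_enormD u v : enorm (u + v) <= enorm u + enorm v.
Proof.
have [u0 v0] := (enorm_ge0 u, enorm_ge0 v).
rewrite -ler_sqr ?nnegrE ?addr_ge0 ?enorm_ge0// sqr_enormD.
by have := dotv_le_enorm u v; nra.
Qed.

Lemma ler_enormB u v : enorm (u - v) <= enorm u + enorm v.
Proof. by rewrite -(enormN v) ler_enormD. Qed.

Lemma continuous_enorm : continuous (@enorm R m).
Proof.
move=> v; apply: continuous_comp; last exact: sqrt_continuous.
move: v; apply: continuous_big => [|i _ v]; first exact: add_continuous.
apply: (@continuous_comp _ _ _ (fun u : 'rV[R]_m => u 0 i) (fun x => x ^+ 2)).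
  exact: coord_continuous.
exact: exprn_continuous.
Qed.

Lemma continuous_dotv w : continuous (dotv w).
Proof.
apply: continuous_big => [|i _ v]; first exact: add_continuous.
have vc : {for v, continuous (fun u : 'rV[R]_m => u 0 i)}.
  exact: coord_continuous.
exact: cvgMl_tmp vc.
Qed.

Lemma is_derive_dotv w (e : R -> 'rV[R]_m) (t : R) (d : 'rV[R]_m) :
  is_derive t 1 e d -> is_derive t 1 (dotv w \o e) (dotv w d).
Proof.
move=> [de De].
have -> : dotv w \o e = \sum_(i < m) w 0 i \*: (fun s => e s 0 i).
  by apply/funext => s /=; rewrite fct_sumE.
apply: is_derive_sum => i; apply: is_deriveZ; split.
  by move/derivable_mxP: de; exact.
by rewrite -De derive_mx// mxE.
Qed.

End EuclideanNorm.

(** * Suprema and Lipschitz constants *)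

(** The bound B serves only to exclude the default value of the supremum of an
    unbounded set. *)
Lemma enorm_le_Linf (R : realType) (X : Type) (m : nat) (D : set X)
    (f : X -> 'rV[R]_m) (B : R) :
  (forall x, D x -> enorm (f x) <= B) ->
  forall x, D x -> enorm (f x) <= Linf D f.
Proof.
move=> fB x Dx; apply: ub_le_sup; last by exists x.
by exists B => _ [y Dy <-]; exact: fB.
Qed.

(** The infimum defining the Lipschitz constant is attained: for fixed points
    at positive distance, every admissible constant is at least the difference
    quotient. *)
Lemma is_lipschitz_const_Lip (R : realType) (m1 m2 : nat)
    (f : 'rV[R]_m1 -> 'rV[R]_m2) :
  is_lipschitz f -> is_lipschitz_const f (Lip f).
Proof.
move=> [L Lf]; have neL : [set K | is_lipschitz_const f K] !=set0 by exists L.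
split; first by apply: lb_le_inf => // K [].
move=> x y; have := enorm_ge0 (x - y); rewrite le_eqVlt => /predU1P[xy0|xy0].
  by move: Lf => [_ /(_ x y)]; rewrite -xy0 !mulr0.
rewrite -ler_pdivrMr//; apply: lb_le_inf => // K [_ Kf].
by rewrite ler_pdivrMr.
Qed.

(** A Lipschitz constant bounds the difference quotients in the direction v,
    hence also their limit, the derivative in that direction. *)
Lemma enorm_mulmx_jacobian (R : realType) (m1 m2 : nat)
    (f : 'rV[R]_m1 -> 'rV[R]_m2) (L : R) (x v : 'rV[R]_m1) :
  is_lipschitz_const f L -> differentiable f x ->
  enorm (v *m 'J f x) <= L * enorm v.
Proof.
move=> [L0 Lf] dfx; rewrite -deriveEjacobian//.
have /(continuous_cvg _ (@continuous_enorm _ _ ('D_v f x))) : derivable f x v.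
  exact: diff_derivable.
move=> /cvgr_to_le; apply.
near=> h; have h0 : h != 0 by near: h; exact: nbhs_dnbhs_neq.
rewrite /= enormZ normfV ler_pdivrMl ?normr_gt0//.
rewrite (le_trans (Lf _ _))// addrK enormZ.
by rewrite mulrCA.
Unshelve. all: by end_near. Qed.

(** * Functions of class C^1 on a set *)

Lemma C1_on_continuous (R : realType) (V W : normedModType R) (K : set V)
    (f : V -> W) : C1_on K f -> {within K, continuous f}.
Proof.
move=> [U [g [oU KU gC1 gf]]]; apply: (@subspace_eq_continuous _ _ _ g).
  by move=> x /set_mem; exact: gf.
apply: continuous_in_subspaceT => x /set_mem/KU Ux.
by apply: differentiable_continuous; have [] := gC1 x Ux.
Qed.

Lemma C1_on_enorm_bounded (R : realType) (V : normedModType R) (m : nat)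
    (K : set V) (f : V -> 'rV[R]_m) :
  compact K -> C1_on K f -> exists B, forall x, K x -> enorm (f x) <= B.
Proof.
move=> cK /C1_on_continuous fc.
have nc : {within K, continuous (@enorm R m \o f)}.
  apply: within_continuous_comp => // x _; exact: continuous_enorm.
have /compact_bounded [B [_ BK]] := continuous_compact nc cK.
exists (B + 1) => x Kx; rewrite -[leLHS]ger0_norm ?enorm_ge0//.
by apply: (BK (B + 1)); [rewrite ltrDl|exists x].
Qed.

Lemma C1_state_continuous (R : realType) (nmu m : nat) (t0 T : R)
    (P : set 'rV[R]_nmu) (u : R -> 'rV[R]_nmu -> 'rV[R]_m) (mu : 'rV[R]_nmu) :
  C1_state t0 T P u -> P mu -> {within `[t0, T]%classic, continuous (u ^~ mu)}.
Proof.
move=> /C1_on_continuous/subspace_continuousP uc Pmu.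
apply/subspace_continuousP => t tD.
apply: cvg_trans (uc (t, mu) _); last by split.
move=> A [[B C] /= [Bt Cmu]] BCA.
apply: (@filterS _ _ _ B) Bt => s Bs sD.
by apply: (BCA (s, mu)); split => //=; exact: nbhs_singleton.
Qed.

(** * Mean value inequality *)

(** At an interior point the one-sided restriction is void: increments h tending
    to 0 correspond to points h + t that eventually lie in the interval. *)
Lemma derivative_within_is_derive (R : realType) (m : nat) (a b t : R)
    (v : R -> 'rV[R]_m) (d : 'rV[R]_m) :
  a < t < b -> derivative_within `[a, b]%classic v t d -> is_derive t 1 v d.
Proof.
move=> tab vd.
have shift_cvg : h *: 1 + t @[h --> (0 : R)^'] --> within `[a, b]%classic t^'.
  have h_cvg : h *: 1 + t @[h --> (0 : R)] --> t.
    have : h *: (1 : R) + t @[h --> (0 : R)] --> 0 *: (1 : R) + t.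
      by apply: cvgD; [apply: cvgZr_tmp; exact: cvg_id|exact: cvg_cst].
    by rewrite scale0r add0r.
  have D : \forall s \near t, `[a, b]%classic s.
    have : t \in `]a, b[ by rewrite in_itv.
    move/near_in_itvoo; apply: filterS => s; exact: subset_itv_oo_cc.
  move=> A At; have {At D} : \forall s \near t, s != t -> A s.
    by apply: filterS2 D At => s sD + st; apply.
  move=> /h_cvg At.
  have {}At : \forall h \near (0 : R), h *: 1 + t != t -> A (h *: 1 + t) := At.
  change (\forall h \near (0 : R)^', A (h *: 1 + t)).
  near=> h; have h0 : h != 0 by near: h; exact: nbhs_dnbhs_neq.
  have hA : h *: 1 + t != t -> A (h *: 1 + t) by near: h; exact: nbhs_dnbhs.
  by apply: hA; rewrite -subr_eq0 addrK [h *: 1]mulr1.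
have D : h^-1 *: (v (h *: 1 + t) - v t) @[h --> 0^'] --> d.
  apply: cvg_trans (cvg_comp _ _ shift_cvg vd).
  apply: near_eq_cvg; near=> h => /=.
  by rewrite addrK [h *: 1]mulr1.
by split; [apply/cvg_ex; exists d|exact: cvg_lim].
Unshelve. all: by end_near. Qed.

(** The scalar mean value theorem, applied to the component of e along the
    total increment e b - e a; Cauchy-Schwarz then bounds the square of the norm
    of this increment by its norm times M (b - a). *)
Lemma enorm_mean_value (R : realType) (m : nat) (a b M : R)
    (e de : R -> 'rV[R]_m) :
  a <= b -> {within `[a, b]%classic, continuous e} ->
  (forall t, a < t < b -> is_derive t 1 e (de t)) ->
  (forall t, a < t < b -> enorm (de t) <= M) ->
  enorm (e b - e a) <= M * (b - a).
Proof.
rewrite le_eqVlt => /predU1P[<- _ _ _|ab ec ed eM].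
  rewrite !subrr mulr0 -(scale0r (0 : 'rV[R]_m)) enormZ normr0 mul0r//.
pose w := e b - e a.
have [||c cab] := @MVT R (dotv w \o e) (dotv w \o de) a b ab.
- by move=> t; rewrite in_itv/= => tab; exact/is_derive_dotv/ed.
- by apply: within_continuous_comp => // x _; exact: continuous_dotv.
rewrite in_itv/= in cab.
rewrite /= -dotvB -/w -sqr_enorm => weq.
have := enorm_ge0 w; rewrite le_eqVlt => /predU1P[<-|w0].
  by rewrite mulr_ge0 ?subr_ge0 ?(ltW ab)// (le_trans _ (eM c cab))// enorm_ge0.
rewrite -(ler_pM2l w0) -expr2 weq mulrA ler_wpM2r ?subr_ge0 ?(ltW ab)//.
by rewrite (le_trans (dotv_le_enorm _ _))// ler_wpM2l ?enorm_ge0 ?eM.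
Qed.

(** * Error decomposition *)

(** Row vectors turn the chain rule J_f(u) u' into a product with the Jacobian on
    the right. *)
Lemma is_derive_decoder (R : realType) (n m : nat) (u : R -> 'rV[R]_n)
    (f : 'rV[R]_n -> 'rV[R]_m) (t : R) (d : 'rV[R]_n) :
  is_derive t 1 u d -> differentiable f (u t) ->
  is_derive t 1 (f \o u) (d *m 'J f (u t)).
Proof.
move=> [du Du] df; have du' := du; move/derivable1_diffP in du'.
split; first by apply/derivable1_diffP; exact: differentiable_comp.
rewrite deriveE; last exact: differentiable_comp.
have dut : 'd u t 1 = d by rewrite -deriveE.
by rewrite diff_comp//= dut -deriveE// deriveEjacobian.
Qed.

Lemma time_grid_itv (R : realType) (t0 T : R) (N k : nat) :
  t0 <= T -> (0 < N)%N -> (k <= N)%N -> t0 <= time_grid t0 T N k <= T.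
Proof.
move=> t0T N0 kN; rewrite /time_grid /time_step.
have /andP[k0 k1] : 0 <= (k%:R / N%:R : R) <= 1.
  by rewrite divr_ge0//= ler_pdivrMr ?ltr0n// mul1r ler_nat.
by rewrite mulrCA; apply/andP; split; nra.
Qed.

Theorem mainTheorem7 (R : realType) (nmu Nh n : nat) (hn : (n < Nh)%N)
    (t0 T : R) (ht : t0 < T) (P : set 'rV[R]_nmu) (hP : compact P)
    (fh : R -> 'rV[R]_Nh -> 'rV[R]_nmu -> 'rV[R]_Nh)
    (u0h : 'rV[R]_nmu -> 'rV[R]_Nh) (uh : R -> 'rV[R]_nmu -> 'rV[R]_Nh)
    (hFOM : full_order_model t0 T P fh u0h uh)
    (Psi : 'rV[R]_Nh -> 'rV[R]_n) (Psi' : 'rV[R]_n -> 'rV[R]_Nh)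
    (fn : R -> 'rV[R]_n -> 'rV[R]_nmu -> 'rV[R]_n)
    (un : R -> 'rV[R]_nmu -> 'rV[R]_n)
    (hLDM : latent_dynamics_model t0 T P u0h uh Psi Psi' fn un)
    (hPsi' : C1_open setT Psi')
    (Phi : increment_function R nmu n) (p : nat) (C : R)
    (horder : forall N : nat, (0 < N)%N ->
       forall k : nat, (k <= N)%N -> forall mu, P mu ->
       enorm (un (time_grid t0 T N k) mu
              - one_step Phi t0 T fn (fun nu => Psi (u0h nu)) N k mu)
         <= C * time_step t0 T N ^+ p) :
  let C1 : R :=
    Linf P (fun mu => u0h mu - Psi' (Psi (u0h mu)))
    + `|T - t0| *
      Linf (`]t0, T]%classic `*` P)
        (fun z : R * 'rV[R]_nmu =>
           fh z.1 (uh z.1 z.2) z.2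
           - fn z.1 (un z.1 z.2) z.2 *m 'J Psi' (un z.1 z.2)) in
  let C2 : R := Lip Psi' * C in
  forall N : nat, (0 < N)%N ->
  forall mu, P mu -> forall k : nat, (k <= N)%N ->
    enorm (uh (time_grid t0 T N k) mu
           - Psi' (one_step Phi t0 T fn (fun nu => Psi (u0h nu)) N k mu))
      <= C1 + C2 * time_step t0 T N ^+ p.
Proof.
move=> C1 C2 N N0 mu Pmu k kN.
have [[_ [Mh fhM] _] uhC1 uhivp] := hFOM.
have [_ decL [_ [Mn fnM] _] [unC1 univp] _] := hLDM.
have Psi'L := is_lipschitz_const_Lip decL; have [Lip0 Psi'Lip] := Psi'L.
have dPsi' x : differentiable Psi' x by have [] := hPsi' x I.
set t := time_grid t0 T N k; set v := one_step _ _ _ _ _ _ _ _.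
have /andP[t0t tT] : t0 <= t <= T by apply: time_grid_itv => //; exact: ltW.
pose e s := uh s mu - Psi' (un s mu).
pose res (z : R * 'rV[R]_nmu) := fh z.1 (uh z.1 z.2) z.2 -
  fn z.1 (un z.1 z.2) z.2 *m 'J Psi' (un z.1 z.2).
have dec_err : enorm (Psi' (un t mu) - Psi' v) <= C2 * time_step t0 T N ^+ p.
  apply: le_trans (Psi'Lip _ _) _; rewrite /C2 -mulrA.
  by apply: ler_wpM2l => //; exact: horder.
have init_err : enorm (e t0) <=
    Linf P (fun mu => u0h mu - Psi' (Psi (u0h mu))).
  rewrite /e (uhivp mu Pmu).2 (univp mu Pmu).2.
  have cK : compact (`[t0, T]%classic `*` P).
    by apply: compact_setX => //; exact: segment_compact.
  have [B uhB] := C1_on_enorm_bounded cK uhC1.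
  have [B' unB] := C1_on_enorm_bounded cK unC1.
  have t0D nu : P nu -> (`[t0, T]%classic `*` P) (t0, nu).
    by split => //=; rewrite in_itv/= lexx ltW.
  apply: (@enorm_le_Linf _ _ _ P (fun mu => u0h mu - Psi' (Psi (u0h mu)))
    (B + (Lip Psi' * B' + enorm (Psi' 0)))) => // nu Pnu.
  apply: le_trans (ler_enormB _ _) _; apply: lerD.
    by have := uhB _ (t0D nu Pnu); rewrite /= (uhivp nu Pnu).2.
  (* The Lipschitz decoder grows at most linearly, starting from Psi' 0. *)
  rewrite -[Psi' _](subrK (Psi' 0)).
  apply: le_trans (ler_enormD _ _) _; apply: lerD => //.
  apply: le_trans (Psi'Lip _ _) _; rewrite subr0; apply: ler_wpM2l => //.
  by have := unB _ (t0D nu Pnu); rewrite /= (univp nu Pnu).2.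
have resM s : t0 < s <= T -> enorm (res (s, mu)) <=
    Linf (`]t0, T]%classic `*` P) res.
  move=> sT.
  apply: (@enorm_le_Linf _ _ _ _ res (Mh + Lip Psi' * Mn)); last first.
    by split => //=; rewrite in_itv.
  move=> [s' nu] [/= s'T Pnu]; rewrite in_itv/= in s'T.
  apply: le_trans (ler_enormB _ _) _; apply: lerD; first exact: fhM.
  apply: le_trans (enorm_mulmx_jacobian _ Psi'L (dPsi' _)) _.
  by apply: ler_wpM2l => //; exact: fnM.
have growth : enorm (e t - e t0) <=
    Linf (`]t0, T]%classic `*` P) res * (t - t0).
  apply: (@enorm_mean_value _ _ _ _ _ _ (fun s => res (s, mu))) => //.
  - apply: (@continuous_subspaceW _ _ _ `[t0, T]%classic).
      by move=> s /=; rewrite !in_itv/= => /andP[-> /le_trans]; apply.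
    apply: within_continuousB; first exact: C1_state_continuous uhC1 Pmu.
    apply: (@within_continuous_comp _ _ _ _ (un ^~ mu) Psi').
      by move=> x _; exact: differentiable_continuous.
    exact: C1_state_continuous unC1 Pmu.
  - move=> s /andP[t0s st]; have sT := lt_le_trans st tT.
    have s0T : t0 < s <= T by rewrite t0s ltW.
    apply: is_deriveB.
      apply: derivative_within_is_derive ((uhivp mu Pmu).1 s s0T).
      by rewrite t0s.
    apply: is_derive_decoder => //.
    apply: derivative_within_is_derive ((univp mu Pmu).1 s s0T).
    by rewrite t0s.
  - by move=> s /andP[t0s st]; apply: resM; rewrite t0s ltW// (lt_le_trans st).
have M0 : 0 <= Linf (`]t0, T]%classic `*` P) res.
  by apply: le_trans (resM T _); rewrite ?enorm_ge0// ht lexx.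
rewrite -(subrK (Psi' (un t mu)) (uh t mu)) -addrA.
apply: le_trans (ler_enormD _ _) _; apply: lerD => //.
rewrite -/(e t) -(subrK (e t0) (e t)) addrC.
apply: le_trans (ler_enormD _ _) _.
rewrite /C1; apply: lerD => //; apply: le_trans growth _.
rewrite mulrC ger0_norm ?subr_ge0 ?(ltW ht)//.
by apply: ler_wpM2r => //; rewrite lerD2r.
Qed.
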